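(* Let $G$ be a graph, let $A\in\mathcal{S}(G)$, and let $\beta\subseteq E(\overline{G})$. (SSP version) If $\beta$ is an SSP liberation set of $A$, then there is a matrix $A'\in\mathcal{S}(G+\beta)$ with the SSP such that $\operatorname{spec}(A)=\operatorname{spec}(A')$. (SAP version) If $\beta$ is an SAP liberation set of $A$, then there is a matrix $A'\in\mathcal{S}(G+\beta)$ with the SAP such that $\operatorname{rank}(A)=\operatorname{rank}(A')$.
   Context: All graphs are finite and simple. For a graph $G$ on $n$ vertices, $\mathcal{S}(G)$ is the set of real symmetric $n\times n$ matrices (rows and columns indexed by $V(G)$) whose $(i,j)$-entry, $i\ne j$, is nonzero if and only if $\{i,j\}\in E(G)$; diagonal entries are unconstrained. $\overline{G}$ is the complement of $G$. For $\beta\subseteq E(\overline{G})$, $G+\beta$ is the graph with vertex set $V(G)$ and edge set $E(G)\cup\beta$. $\mathcal{S}_0^{\rm cl}(G)$ is the set of real symmetric matrices with zero diagonal whose $(i,j)$-entry is nonzero only if $\{i,j\}\in E(G)$. $\operatorname{spec}(A)$ is the multiset of eigenvalues of $A$. $[A,X]=AX-XA$, and $O$ is the zero matrix. Let $G$ be a spanning subgraph of $H$ (i.e. $V(G)=V(H)$, $E(G)\subseteq E(H)$) and $A\in\mathcal{S}(G)$. $A$ has the SSP with respect to $H$ if $X=O$ is the only symmetric matrix with $X\in\mathcal{S}_0^{\rm cl}(\overline{H})$ and $[A,X]=O$. $A$ has the SAP with respect to $H$ if $X=O$ is the only symmetric matrix with $X\in\mathcal{S}_0^{\rm cl}(\overline{H})$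 and $AX=O$. $A\in\mathcal{S}(G)$ has the SSP (strong spectral property), respectively the SAP (strong Arnold property), if it has it with respect to $G$ itself. A nonempty set $\beta\subseteq E(\overline{G})$ is an SSP (respectively SAP) liberation set of $A\in\mathcal{S}(G)$ if $A$ has the SSP (respectively the SAP) with respect to $G+\beta'$ for all $\beta'\subset\beta$ with $|\beta'|=|\beta|-1$. *)

(* Defs.v *)
From HB Require Import structures.
From mathcomp Require Import all_boot all_order all_algebra.
From mathcomp Require Import finmap multiset polyrcf reals.

Set Implicit Arguments.
Unset Strict Implicit.
Unset Printing Implicit Defensive.

Import Order.TTheory GRing.Theory Num.Theory.
Local Open Scope ring_scope.

Record sgraph (V : finType) := SGraph {
  adj :> rel V;
  adj_sym : symmetric adj;
  adj_irr : irreflexive adj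
}.

Section Graph.
Variable V : finType.

Definition edges (G : sgraph V) : {set {set V}} :=
  [set [set i; j] | i in V, j in G i].

Lemma mem_edges (G : sgraph V) i j : ([set i; j] \in edges G) = G i j.
Proof.
apply/imset2P/idP => [[k l _ Gkl eq_ij] | Gij]; last by exists i j.
have : k \in [set i; j] by rewrite eq_ij set21.
have : l \in [set i; j] by rewrite eq_ij set22.
have {}Gkl : G k l by [].
rewrite !inE => /orP[] /eqP El /orP[] /eqP Ek; subst k l => //.
- by rewrite adj_irr in Gkl.
- by rewrite adj_sym.
- by rewrite adj_irr in Gkl.
Qed.

Definition compl_rel (G : sgraph V) : rel V := fun i j => (i != j) && ~~ G i j.

Lemma compl_sym G : symmetric (compl_rel G).
Proof. by move=> i j; rewrite /compl_rel eq_sym adj_sym. Qed.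

Lemma compl_irr G : irreflexive (compl_rel G).
Proof. by move=> i; rewrite /compl_rel eqxx. Qed.

Definition compl (G : sgraph V) : sgraph V :=
  SGraph (compl_sym G) (compl_irr G).

(* The guard [i != j] discards any singleton [set i; i] in b, so that the
   result is simple for every b; it is redundant when b \subset edges (compl G). *)
Definition add_rel (G : sgraph V) (b : {set {set V}}) : rel V :=
  fun i j => (i != j) && (G i j || ([set i; j] \in b)).

Lemma add_sym G b : symmetric (add_rel G b).
Proof. by move=> i j; rewrite /add_rel eq_sym adj_sym setUC. Qed.

Lemma add_irr G b : irreflexive (add_rel G b).
Proof. by move=> i; rewrite /add_rel eqxx. Qed.

Definition add_edges (G : sgraph V) (b : {set {set V}}) : sgraph V :=
  SGraph (add_sym G b) (add_irr G b).

End Graph.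

Section Matrices.
Variables (R : realType) (n : nat).
Implicit Types (G H : sgraph 'I_n) (A X : 'M[R]_n) (b : {set {set 'I_n}}).

Definition in_S G A : Prop :=
  A^T = A /\ forall i j, i != j -> (A i j != 0) = G i j.

Definition in_S0cl G X : Prop :=
  [/\ X^T = X, forall i, X i i = 0 & forall i j, X i j != 0 -> G i j].

Definition has_SSP_wrt H A : Prop :=
  forall X, in_S0cl (compl H) X -> A *m X - X *m A = 0 -> X = 0.

Definition has_SAP_wrt H A : Prop :=
  forall X, in_S0cl (compl H) X -> A *m X = 0 -> X = 0.

Definition SSP_liberation_set G A b : Prop :=
  [/\ b != set0, b \subset edges (compl G) &
      forall b' : {set {set 'I_n}},
        b' \subset b -> #|b'| = #|b|.-1 -> has_SSP_wrt (add_edges G b') A].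

Definition SAP_liberation_set G A b : Prop :=
  [/\ b != set0, b \subset edges (compl G) &
      forall b' : {set {set 'I_n}},
        b' \subset b -> #|b'| = #|b|.-1 -> has_SAP_wrt (add_edges G b') A].

(* Only the eigenvalues in R are counted, with algebraic multiplicity; for a
   symmetric A these are all n of them. *)
Definition spec A : {mset R}%mset :=
  seq_mset (flatten [seq nseq (mup x (char_poly A)) x
                    | x <- rootsR (char_poly A)]).

Lemma specE A x : spec A x = mup x (char_poly A).
Proof.
rewrite /spec; set p := char_poly A; set r := rootsR p.
have p_neq0 : p != 0 by apply/monic_neq0/char_poly_monic.
have uniq_r : uniq r by exact: uniq_roots.
have mem_r : root p x = (x \in r) by rewrite -(roots_on_rootsR p_neq0) in_itv.
rewrite mset_seqE count_flatten -map_comp sumnE big_map.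
rewrite (eq_bigr (fun y => (y == x) * mup x p)%N); last first.
  by move=> y _ /=; rewrite count_nseq /=; case: eqP => [->|].
rewrite -big_distrl /=.
have := sumn_count (pred1 x) r; rewrite sumnE big_map /= => ->.
rewrite count_uniq_mem // -mem_r.
by have [|/mupNroot ->] := boolP (root p x); rewrite ?mul1n.
Qed.

End Matrices.

(* Main.v *)
Require Import Defs.
From HB Require Import structures.
From mathcomp Require Import all_boot all_order all_algebra reals.
From mathcomp Require Import boolp classical_sets functions interval_inference.
From mathcomp Require Import topology prodnormedzmodule normedtype sequences.
From mathcomp Require Import ring lra.

(** Moving [A] by orthogonal similarities (SSP) or by congruences (SAP) traces
    out a manifold on which the spectrum, respectively the rank, is constant.
    Its tangent space at [A] is the image of a linear map [T A] into the
    symmetric matrices, and the cyclicity of the trace shows that the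
    strong property with respect to [H] says exactly this: no nonzero
    matrix supported on the non-edges of [H] is orthogonal to that tangent
    space.  This is called [transverse (T A) H] below.  By duality
    ([transverse_solve]) it means that tangent vectors together with the
    symmetric matrices supported on [H] span all symmetric matrices.

    Let [b] be a liberation set of [A] and [H := G + b].  For each edge [f] of
    [b], transversality with respect to [G + (b - f)] gives a tangent vector
    that is supported on [H] and is nonzero at [f]; a generic combination of
    these is nonzero on all of [b] ([generic_direction]).  Transversality with
    respect to [H] itself then allows to follow this direction inside the
    manifold while staying in the space of matrices supported on [H]: this is
    an implicit function theorem, obtained here from the contraction principle
    ([vanishing_fixpoint], [liberation_perturbation]).  For a small positive
    parameter the resulting matrix [A + E] is nonzero on [b] by the choice of
    the direction, nonzero on the edges of [G] because [E] is small, zero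
    elsewhere, and transverse to [H] because transversality is an open
    condition ([transverse_open]).

    To have polynomial equations, an orthogonal similarity is written as a
    Cayley transform: with [K] skew and [B := A + E], the equation
    [(1 + K) B (1 - K) = (1 - K) A (1 + K)] forces [A] and [B] to have the same
    characteristic polynomial ([char_poly_equiv]).  It reads
    [E = 2 (A K - K A) + (E K - K E + K E K)], a linear tangent term and a
    remainder of order two.  A congruence [B = (1 + Z)^T A (1 + Z)] reads
    [E = (Z^T A + A Z) + Z^T A Z].  Both cases are instances of the same
    perturbation lemma. *)

Set Implicit Arguments.
Unset Strict Implicit.
Unset Printing Implicit Defensive.

Import Order.TTheory GRing.Theory Num.Theory.
Import numFieldNormedType.Exports.

Local Open Scope ring_scope.

(** * Linear algebra *)

Section LinearAlgebra.
Variables (R : realType) (n : nat).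
Implicit Types X Y Z W : 'M[R]_n.

(** Turns the pairing of coordinate vectors into the trace pairing, for which
    the cyclic property is available. *)
Lemma mxvec_dot X Z : mxvec Z *m (mxvec X^T)^T = (\tr (X *m Z))%:M.
Proof.
rewrite [LHS]mx11_scalar; congr (_%:M); rewrite mxE.
rewrite (reindex _ (curry_mxvec_bij _ _)) /= mxtrace_mulC /mxtrace.
under [RHS]eq_bigr do rewrite mxE.
rewrite pair_bigA /=; apply: eq_bigr => -[i j] _ /=.
by rewrite [X in _ * X]mxE !mxvecE mxE.
Qed.

(** Duality: a subspace of matrices contains another one as soon as its
    annihilator for the trace pairing is contained in the other annihilator.
    The factorization is linear because it comes from a matrix identity between
    [lin_mx h], [lin_mx f] and [lin_mx g]. *)
Lemma linear_factor_sum (f g h : {linear 'M[R]_n -> 'M[R]_n}) :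
  (forall X, (forall Z, \tr (X *m f Z) = 0) ->
     (forall Z, \tr (X *m g Z) = 0) -> forall Z, \tr (X *m h Z) = 0) ->
  exists S1 S2 : {linear 'M[R]_n -> 'M[R]_n},
    forall W, h W = f (S1 W) + g (S2 W).
Proof.
move=> annih.
have col_mulmx p q s j (M : 'M[R]_(p, q)) (N : 'M[R]_(q, s)) :
    col j (M *m N) = M *m col j N by rewrite !colE mulmxA.
have /sub_addsmxP[[D1 D2] /= hE] : (lin_mx h <= lin_mx f + lin_mx g)%MS.
  set F := (_ + _)%MS; rewrite submxE; apply/eqP/matrixP => i j.
  (* The columns of the cokernel are the functionals that vanish on [F]. *)
  pose X := (vec_mx (col j (cokermx F))^T)^T.
  have colX : col j (cokermx F) = (mxvec X^T)^T.
    by rewrite trmxK vec_mxK trmxK.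
  have kill (k : {linear 'M[R]_n -> 'M[R]_n}) :
      (lin_mx k <= F)%MS -> forall Z, \tr (X *m k Z) = 0.
    move=> kF Z; have /eqP : (mxvec Z *m lin_mx k *m cokermx F == 0).
      by rewrite -submxE (submx_trans (submxMl _ _)).
    rewrite mul_vec_lin => /(congr1 (col j)); rewrite col_mulmx colX mxvec_dot.
    by move=> /matrixP/(_ 0 0); rewrite !mxE eqxx mulr1n.
  have /(_ (vec_mx (delta_mx 0 i))) :=
    annih X (kill f (addsmxSl _ _)) (kill g (addsmxSr _ _)).
  move=> tr0; have := mxvec_dot X (h (vec_mx (delta_mx 0 i))).
  rewrite tr0 -mul_vec_lin vec_mxK -colX -mulmxA -col_mulmx -rowE.
  by move=> /matrixP/(_ 0 0); rewrite !mxE eqxx.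
pose S (D : 'M[R]_(n * n)) : {linear 'M[R]_n -> 'M[R]_n} :=
  vec_mx \o mulmxr D \o mxvec.
exists (S D1), (S D2) => W; rewrite /S /=.
apply: (can_inj mxvecK); rewrite linearD /= -(mul_vec_lin h) -(mul_vec_lin f).
rewrite -(mul_vec_lin g) !vec_mxK hE.
by rewrite mulmxDr !mulmxA.
Qed.

(** As [U] and [V] commute, [U (x - B) V = V (x - A) U] over the polynomials;
    taking determinants, those of [U] and [V] cancel. *)
Lemma char_poly_equiv (A B U V : 'M[R]_n) :
  U \in unitmx -> V \in unitmx -> U *m V = V *m U ->
  U *m B *m V = V *m A *m U -> char_poly A = char_poly B.
Proof.
rewrite !unitmxE !unitfE => Unz Vnz UV UBV.
have dnz (X : 'M[R]_n) : \det X != 0 -> \det (map_mx (@polyC R) X) != 0.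
  by move=> ?; rewrite det_map_mx polyC_eq0.
have: \det (map_mx (@polyC R) U *m char_poly_mx B *m map_mx (@polyC R) V) =
      \det (map_mx (@polyC R) V *m char_poly_mx A *m map_mx (@polyC R) U).
  congr (\det _); rewrite /char_poly_mx !mulmxBr !mulmxBl -!map_mxM UBV.
  by rewrite !(scalar_mxC 'X) -!mulmxA -!map_mxM UV.
rewrite !det_mulmx -/(char_poly A) -/(char_poly B).
move=> e; apply: (mulfI (dnz _ Vnz)); apply: (mulIf (dnz _ Unz)).
by rewrite -e; ring.
Qed.

(** If [v = v K] with [K] skew then [v v^T = v K v^T] is its own opposite. *)
Lemma skew_unit (K : 'M[R]_n) : K^T = - K -> 1%:M - K \in unitmx.
Proof.
move=> Ks; rewrite -row_free_unit -kermx_eq0; apply/eqP/row_matrixP => i.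
rewrite row0; set v := row i _.
have vK : v = v *m K.
  have /eqP : v *m (1%:M - K) = 0 by rewrite -row_mul mulmx_ker row0.
  by rewrite mulmxBr mulmx1 subr_eq0 => /eqP.
have vv0 : v *m v^T = 0.
  have e : (v *m v^T)^T = - (v *m v^T).
    by rewrite {1}vK !trmx_mul Ks trmxK mulNmx mulmxN mulmxA -vK.
  move: (v *m v^T) e => s /matrixP e; apply/matrixP => a b.
  by have := e b a; rewrite !ord1 !mxE => {}e; lra.
apply/rowP => j; move/matrixP: vv0 => /(_ 0 0); rewrite mxE [RHS]mxE.
move=> /eqP; rewrite psumr_eq0 => [|k _]; last first.
  by rewrite [_^T _ _]mxE -expr2 sqr_ge0.
move=> /allP/(_ j); rewrite mem_index_enum [_^T _ _]mxE mulf_eq0 orbb.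
by move=> /(_ isT)/eqP ->; rewrite mxE.
Qed.

End LinearAlgebra.

(** * The maximum norm on matrices *)

Section Norms.
Variable R : realType.

Lemma ler_mx_norm m n (X : 'M[R]_(m, n)) i j : `|X i j| <= `|X|.
Proof.
rewrite [leRHS]/Num.Def.normr /= mx_normrE; apply/bigmax_geP; right => /=.
by exists (i, j).
Qed.

Lemma mx_norm_le m n (X : 'M[R]_(m, n)) c :
  0 <= c -> (forall i j, `|X i j| <= c) -> `|X| <= c.
Proof.
move=> c0 Xc; rewrite [leLHS]/Num.Def.normr /= mx_normrE.
by apply/bigmax_leP; split => // -[i j] _; exact: Xc.
Qed.

Lemma ler_norm_mulmx m n p (X : 'M[R]_(m, n)) (Y : 'M[R]_(n, p)) :
  `|X *m Y| <= n%:R * (`|X| * `|Y|).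
Proof.
apply: mx_norm_le => [|i j]; first by rewrite !mulr_ge0.
rewrite mxE (le_trans (ler_norm_sum _ _ _)) //.
rewrite (le_trans (ler_sum _ (G := fun=> `|X| * `|Y|) _)) //; last first.
  by rewrite sumr_const card_ord mulr_natl.
by move=> k _; rewrite normrM ler_pM // ler_mx_norm.
Qed.

Lemma ler_norm_trmx m n (X : 'M[R]_(m, n)) : `|X^T| <= `|X|.
Proof. by apply: mx_norm_le => // i j; rewrite mxE ler_mx_norm. Qed.

Lemma ler_norm_mxtrace n (X : 'M[R]_n) : `|\tr X| <= n%:R * `|X|.
Proof.
rewrite /mxtrace (le_trans (ler_norm_sum _ _ _)) //.
rewrite (le_trans (ler_sum _ (G := fun=> `|X|) _)) //; last first.
  by rewrite sumr_const card_ord mulr_natl.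
by move=> k _; rewrite ler_mx_norm.
Qed.

Lemma ler_sqr_norm_sym n (X : 'M[R]_n) : X^T = X -> `|X| ^+ 2 <= \tr (X *m X).
Proof.
move=> Xs.
have trE : \tr (X *m X) = \sum_i \sum_j X i j ^+ 2.
  rewrite -{1}Xs; rewrite mxtrace_mulC /mxtrace; apply: eq_bigr => i _.
  by rewrite mxE; apply: eq_bigr => j _; rewrite mxE expr2.
have tr0 : 0 <= \tr (X *m X).
  by rewrite trE sumr_ge0 // => i _; rewrite sumr_ge0 // => j _; exact: sqr_ge0.
rewrite -[leRHS]sqr_sqrtr // ler_pXn2r ?nnegrE ?sqrtr_ge0 //.
apply: mx_norm_le => [|i j]; first exact: sqrtr_ge0.
rewrite -sqrtr_sqr ler_wsqrtr // trE (bigD1 i) //= (bigD1 j) //= -addrA lerDl.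
rewrite addr_ge0 ?sumr_ge0 // => k _; first exact: sqr_ge0.
by rewrite sumr_ge0 // => l _; exact: sqr_ge0.
Qed.

Lemma linear_mx_bounded m n (V : normedModType R)
    (S : {linear 'M[R]_(m, n) -> V}) :
  exists2 c, 0 <= c & forall W, `|S W| <= c * `|W|.
Proof.
exists (\sum_i \sum_j `|S (delta_mx i j)|) => [|W].
  by rewrite sumr_ge0 // => i _; rewrite sumr_ge0.
rewrite {1}(matrix_sum_delta W) linear_sum mulr_suml.
apply: le_trans (ler_norm_sum _ _ _) _; apply: ler_sum => i _.
rewrite linear_sum mulr_suml.
apply: le_trans (ler_norm_sum _ _ _) _; apply: ler_sum => j _.
by rewrite linearZ normrZ mulrC ler_wpM2l // ler_mx_norm.
Qed.

Lemma nonzero_entries_bound m n (X : 'M[R]_(m, n)) :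
  exists2 d, 0 < d & forall i j, X i j != 0 -> d <= `|X i j|.
Proof.
pose D := \sum_i \sum_j `|X i j|^-1.
have D0 : 0 <= D by rewrite sumr_ge0 // => i _; rewrite sumr_ge0.
exists (D + 1)^-1 => [|i j Xnz]; first by rewrite invr_gt0 ltr_wpDl.
rewrite -[leRHS]invrK lef_pV2 ?posrE ?invr_gt0 ?normr_gt0 ?ltr_wpDl //.
rewrite ler_wpDr // /D (bigD1 i) //= (bigD1 j) //= -addrA lerDl.
by rewrite addr_ge0 // sumr_ge0 // => k _; rewrite sumr_ge0.
Qed.

End Norms.

(** * Transversality to a pattern *)

Section Transversality.
Variables (R : realType) (n : nat).
Implicit Types (G H : sgraph 'I_n) (A B X Z W : 'M[R]_n).
Implicit Types (T : {linear 'M[R]_n -> 'M[R]_n}).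

(** The image of [T] meets the matrices supported on [H] transversally inside
    the symmetric matrices, expressed through the orthogonal complements. *)
Definition transverse T H :=
  forall X, in_S0cl (compl H) X -> (forall Z, \tr (X *m T Z) = 0) -> X = 0.

Definition in_Scl H X :=
  X^T = X /\ forall i j, i != j -> ~~ H i j -> X i j = 0.

(** A linear map onto the symmetric matrices supported on [H] and the
    diagonal, defined on all matrices so that [lin_mx] applies. *)
Definition sym_restr H Z : 'M[R]_n :=
  \matrix_(i, j) if (i == j) || H i j then Z i j + Z j i else 0.

Lemma sym_restr_is_linear H : linear (sym_restr H).
Proof.
move=> a X Y; apply/matrixP => i j; rewrite !mxE.
by case: ifP => _; [ring | rewrite mulr0 addr0].
Qed.
HB.instance Definition _ H := GRing.isLinear.Build R 'M[R]_n 'M[R]_n _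
  (sym_restr H) (sym_restr_is_linear H).

Lemma sym_restr_delta H i j : (i == j) || H i j ->
  sym_restr H (delta_mx i j) = delta_mx i j + delta_mx j i.
Proof.
move=> ijH; apply/matrixP => k l; rewrite !mxE.
case: ifP => [_|/negbT nkl].
  by rewrite [X in _ + (nat_of_bool X)%:R]andbC.
have -> : ((k == i) && (l == j)) = false.
  by apply: contraNF nkl => /andP[/eqP -> /eqP ->].
have -> : ((k == j) && (l == i)) = false.
  by apply: contraNF nkl => /andP[/eqP -> /eqP ->]; rewrite eq_sym adj_sym.
by rewrite addr0.
Qed.

Lemma mxtrace_mul_delta X i j : \tr (X *m delta_mx i j) = X j i.
Proof.
rewrite /mxtrace (bigD1 j) //= big1 => [|k kj]; rewrite mxE.
  rewrite (bigD1 i) //= big1 => [|l li]; rewrite mxE ?eqxx ?mulr1 ?addr0 //.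
  by rewrite (negbTE li) mulr0.
by rewrite big1 // => l _; rewrite mxE (negbTE kj) andbF mulr0.
Qed.

Lemma sym_restr_in_Scl H Z : in_Scl H (sym_restr H Z).
Proof.
split=> [|i j /negbTE ij /negbTE nH]; last by rewrite mxE ij nH.
by apply/matrixP => i j; rewrite !mxE eq_sym adj_sym addrC.
Qed.

Lemma in_S0cl_compl_diag_adj H X i j :
  in_S0cl (compl H) X -> (i == j) || H i j -> X i j = 0.
Proof.
move=> [_ X0 Xsupp] /orP[/eqP <- // | Hij].
by apply/eqP; apply: contraTT Hij => /Xsupp /andP[].
Qed.

(** A matrix [X] orthogonal to the image of [T] and to the matrices supported
    on [H] has a symmetrization that is still orthogonal to the image of [T], is
    supported off [H], and hence vanishes; so [X] is orthogonal to all symmetric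
    matrices, and duality applies. *)
Lemma transverse_solve T H : (forall Z, (T Z)^T = T Z) -> transverse T H ->
  exists S1 S2 : {linear 'M[R]_n -> 'M[R]_n},
    (forall W, W^T = W -> W = T (S1 W) + S2 W) /\ forall W, in_Scl H (S2 W).
Proof.
move=> Tsym trT.
pose h : {linear 'M[R]_n -> 'M[R]_n} := idfun \+ trmx.
have [X XT XE Z|S1 [S2 hE]] := @linear_factor_sum R n T (sym_restr H) h.
  have Xs0 : X + X^T = 0.
    apply: trT => [|{}Z]; last first.
      rewrite mulmxDl linearD /= XT add0r -mxtrace_tr trmx_mul trmxK Tsym.
      by rewrite mxtrace_mulC XT.
    have XH i j : (i == j) || H i j -> (X + X^T) i j = 0.
      move=> ijH; have := XE (delta_mx i j); rewrite /= sym_restr_delta //.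
      by rewrite mulmxDr linearD /= !mxtrace_mul_delta !mxE addrC.
    split=> [|i|i j].
    - by rewrite linearD /= trmxK addrC.
    - by rewrite XH ?eqxx.
    - apply: contraR; rewrite /= /compl_rel negb_and !negbK => /XH ->.
      by rewrite eqxx.
  rewrite /= mulmxDr linearD /= -[X in _ + X]mxtrace_tr trmx_mul trmxK.
  by rewrite [X in _ + X]mxtrace_mulC -linearD -mulmxDl Xs0 mul0mx linear0.
exists (2^-1 \*: S1), (2^-1 \*: (sym_restr H \o S2)); split=> [W Ws|W /=].
  have /esym := hE W; rewrite /= Ws linearZ /= -scalerDr => ->.
  by rewrite scalerDr -scalerDl -div1r -splitr scale1r.
have [sW W0] := sym_restr_in_Scl H (S2 W); split=> [|i j ij nH].
  by rewrite linearZ /= sW.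
by rewrite mxE W0 ?mulr0.
Qed.

Lemma Scl_S0cl_tr H E X : in_Scl H E -> in_S0cl (compl H) X -> \tr (X *m E) = 0.
Proof.
move=> [_ E0] hX; rewrite /mxtrace big1 // => i _; rewrite mxE big1 // => j _.
have [ijH|] := boolP ((i == j) || H i j).
  by rewrite (in_S0cl_compl_diag_adj hX ijH) mul0r.
by rewrite negb_or => /andP[ij nH]; rewrite E0 ?mulr0 // 1?eq_sym // adj_sym.
Qed.

(** The solution operator [S1] for [A] bounds the norm of an [X] supported off
    [H] and orthogonal to the image of [T B]: splitting one factor of [X X] into
    its tangent and its supported part, only the difference of [T A] and [T B]
    contributes to the trace, so that [|X|^2 <= C |B - A| |X|^2]. *)
Lemma transverse_open (T : 'M[R]_n -> {linear 'M[R]_n -> 'M[R]_n}) A H c :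
  (forall Z, (T A Z)^T = T A Z) ->
  (forall B Z, `|T B Z - T A Z| <= c * (`|B - A| * `|Z|)) ->
  transverse (T A) H ->
  exists2 e, 0 < e & forall B, `|B - A| <= e -> transverse (T B) H.
Proof.
move=> Tsym Tlip trA.
have [S1 [S2 [solve S2H]]] := transverse_solve Tsym trA.
have [s s0 S1s] := linear_mx_bounded S1.
pose C := n%:R * n%:R * `|c| * s.
have C0 : 0 <= C by rewrite !mulr_ge0.
exists (C + 1)^-1 => [|B BA X hX XT]; first by rewrite invr_gt0; lra.
have Xs : X^T = X by case: hX.
have trXX : \tr (X *m X) = \tr (X *m (T A (S1 X) - T B (S1 X))).
  rewrite {2}(solve X Xs) mulmxDr mulmxBr linearD linearB /= XT subr0.
  by rewrite (Scl_S0cl_tr (S2H X) hX) addr0.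
have := ler_sqr_norm_sym Xs; rewrite trXX => leX.
have C1 : C * (C + 1)^-1 < 1 by rewrite ltr_pdivrMr; lra.
move: (C + 1)^-1 BA C1 => d BA C1.
have {}leX : `|X| ^+ 2 <= C * d * `|X| ^+ 2.
  apply: le_trans leX _; apply: le_trans (ler_norm _) _.
  apply: le_trans (ler_norm_mxtrace _) _.
  rewrite /C expr2 -!mulrA ler_wpM2l //.
  apply: le_trans (ler_norm_mulmx _ _) _; rewrite ler_wpM2l //.
  rewrite [leRHS](_ : _ = `|X| * (`|c| * (d * (s * `|X|)))); last by ring.
  rewrite ler_wpM2l // distrC (le_trans (Tlip _ _)) //.
  apply: le_trans (ler_wpM2r _ (ler_norm c)) _; first by rewrite mulr_ge0.
  by rewrite ler_wpM2l // ler_pM.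
apply/eqP; rewrite -normr_eq0 -sqrf_eq0; apply/eqP; have := sqr_ge0 `|X|; nra.
Qed.

Lemma in_S0cl_sub G H X :
  subrel G H -> in_S0cl G X -> in_S0cl H X.
Proof. by move=> GH [Xs X0 XG]; split=> // i j /XG; apply: GH. Qed.

Lemma compl_sub G H : subrel G H -> subrel (compl H) (compl G).
Proof.
move=> GH i j /andP[ij nH]; apply/andP; split=> //.
by apply: contra nH; apply: GH.
Qed.

Lemma transverse_sub T G H : subrel G H -> transverse T G -> transverse T H.
Proof. by move=> GH trG X /(in_S0cl_sub (compl_sub GH)); apply: trG. Qed.

(** For an edge [f = {k, l}] of [b], solving for the symmetric unit matrix [D]
    at [f] with the pattern [H + (b - f)] gives a tangent vector [T Y] equal to
    [1] at [f] and supported on [H + b].  The edges are added one at a time: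
    [Z + c Y] keeps the nonzero entries of [T Z] and gains the one at [f] unless
    [c] is one of finitely many ratios. *)
Lemma generic_direction T H (b : {set {set 'I_n}}) :
  (forall Z, (T Z)^T = T Z) ->
  (forall f, f \in b -> f \in edges (compl H)) ->
  (forall f, f \in b -> transverse T (add_edges H (b :\ f))) ->
  exists Z, in_Scl (add_edges H b) (T Z) /\
    forall i j, [set i; j] \in b -> T Z i j != 0.
Proof.
move=> Tsym bH trT.
pose P (s : seq ('I_n * 'I_n)) := exists Z, in_Scl (add_edges H b) (T Z) /\
  forall p, p \in s -> T Z p.1 p.2 != 0.
suff: P [seq p <- enum {: 'I_n * 'I_n} | [set p.1; p.2] \in b].
  move=> [Z [TZ Znz]]; exists Z; split=> // i j ijb.
  by apply: (Znz (i, j)); rewrite mem_filter ijb mem_enum.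
have: all (fun p : 'I_n * 'I_n => [set p.1; p.2] \in b)
   [seq p <- enum {: 'I_n * 'I_n} | [set p.1; p.2] \in b] by exact: filter_all.
elim: [seq _ <- _ | _] => [_|[k l] s IHs /= /andP[klb /IHs[Z [[_ ZH] Znz]]]].
  exists 0; rewrite linear0; split=> //.
  by split=> [|i j _ _]; rewrite ?trmx0 ?mxE.
have /andP[kl nHkl] : compl_rel H k l by have := bH _ klb; rewrite mem_edges.
have [S1 [S2 [solve S2H]]] := transverse_solve Tsym (trT _ klb).
pose D : 'M[R]_n := delta_mx k l + delta_mx l k.
have Ds : D^T = D by rewrite /D linearD /= !trmx_delta addrC.
pose Y := S1 D.
have TYE : T Y = D - S2 D by rewrite {1}(solve D Ds) addrK.
have [_ S2D] := S2H D.
have Ykl : T Y k l = 1.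
  rewrite TYE mxE [D _ _]mxE !mxE !eqxx /= (negbTE kl) /= addr0.
  by rewrite S2D ?oppr0 ?addr0 //= /add_rel kl /= negb_or nHkl !inE eqxx.
have YH : in_Scl (add_edges H b) (T Y).
  split=> [|i j ij nij]; first exact: Tsym.
  have notb : [set i; j] \notin b.
    by apply: contra nij => ijb; rewrite /= /add_rel ij ijb orbT.
  have nf p q : [set p; q] = [set k; l] -> (i == p) && (j == q) = false.
    by move=> pq; apply: contraNF notb => /andP[/eqP -> /eqP ->]; rewrite pq.
  rewrite TYE mxE [D _ _]mxE !mxE !nf //; last exact: finset.setUC.
  have -> : S2 D i j = 0; last by rewrite addr0 oppr0 addr0.
  apply: S2D => //; apply: contra nij.
  rewrite /= /add_rel ij /= => /orP[->//|].
  by rewrite !inE => /andP[_ ->]; rewrite orbT.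
(* Larger in absolute value than each ratio to be avoided. *)
pose c := 1 + \sum_(p <- (k, l) :: s) `|T Z p.1 p.2 / T Y p.1 p.2|.
exists (Z + c *: Y); split.
  split=> [|i j ij nij]; first exact: Tsym.
  rewrite linearD linearZ mxE [X in _ + X]mxE ZH // add0r.
  by case: YH => _ ->; rewrite ?mulr0.
move=> p ps; rewrite linearD linearZ mxE [X in _ + X]mxE.
have [Y0|Ynz] := eqVneq (T Y p.1 p.2) 0.
  rewrite Y0 mulr0 addr0; apply: Znz; move: ps; rewrite inE => /predU1P[pE|//].
  by move/eqP: Y0; rewrite pE Ykl oner_eq0.
rewrite addrC -[T Z _ _](divfK Ynz) -mulrDl mulf_neq0 //.
have : `|T Z p.1 p.2 / T Y p.1 p.2| < c.
  by rewrite /c (big_rem p) //= addrCA ltrDl ltr_pwDl // sumr_ge0.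
by rewrite ltr_norml => /andP[cx _]; rewrite gt_eqF // -ltrBlDl sub0r.
Qed.

End Transversality.

(** * A quadratic fixed-point lemma *)

(** Joins the complete and the normed structures that matrices already carry;
    the contraction principle needs both. *)
HB.instance Definition _ (R : realType) (m n : nat) :=
  Complete.on 'M[R]_(m, n).

Section Vanishing.
Variable R : realType.

(** [f] has size [O(rho^(k+1))] and Lipschitz constant [O(rho^k)] on the ball of
    radius [rho]: zero of order [k + 1] at the origin, in the form needed for
    contractions.  The shift by one keeps the exponents natural numbers. *)
Definition vanishing (V W : normedModType R) (k : nat) (f : V -> W) :=
  exists2 C, 0 <= C & forall rho x y, rho <= 1 -> `|x| <= rho -> `|y| <= rho ->
    `|f x| <= C * rho ^+ k.+1 /\ `|f x - f y| <= C * rho ^+ k * `|x - y|.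

Lemma vanishingD (V W : normedModType R) k (f g : V -> W) :
  vanishing k f -> vanishing k g -> vanishing k (f \+ g).
Proof.
move=> [C C0 fC] [D D0 gD]; exists (C + D) => [|r x y r1 xr yr].
  exact: addr_ge0.
have [f1 f2] := fC _ _ _ r1 xr yr; have [g1 g2] := gD _ _ _ r1 xr yr; split.
  by rewrite mulrDl (le_trans (ler_normD _ _)) // lerD.
by rewrite /= opprD addrACA !mulrDl (le_trans (ler_normD _ _)) // lerD.
Qed.

Lemma vanishingN (V W : normedModType R) k (f : V -> W) :
  vanishing k f -> vanishing k (-%R \o f).
Proof.
move=> [C C0 fC]; exists C => // r x y r1 xr yr; have [] := fC _ _ _ r1 xr yr.
by rewrite /= -opprD !normrN.
Qed.

Lemma vanishing_weaken (V W : normedModType R) k (f : V -> W) :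
  vanishing k.+1 f -> vanishing k f.
Proof.
move=> [C C0 fC]; exists C => // r x y r1 xr yr.
have r0 : 0 <= r by apply: le_trans xr.
have pow j : r ^+ j.+1 <= r ^+ j by rewrite exprS ler_piMl // exprn_ge0.
have [f1 f2] := fC _ _ _ r1 xr yr; split.
  by rewrite (le_trans f1) // ler_wpM2l.
by rewrite (le_trans f2) // ler_wpM2r // ler_wpM2l.
Qed.

Lemma vanishing_linear (V W : normedModType R) (f : {linear V -> W}) c :
  (forall x, `|f x| <= c * `|x|) -> vanishing 0 f.
Proof.
move=> fc; exists `|c| => // r x y r1 xr yr; rewrite expr0 mulr1 -linearB.
have fc' z : `|f z| <= `|c| * `|z|.
  by rewrite (le_trans (fc z)) // ler_wpM2r // ler_norm.
by split=> //; rewrite (le_trans (fc' x)) // ler_wpM2l.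
Qed.

Lemma vanishing_mulmx (V : normedModType R) m n p j k
    (f : V -> 'M[R]_(m, n)) (g : V -> 'M[R]_(n, p)) :
  vanishing j f -> vanishing k g -> vanishing (j + k).+1 (fun x => f x *m g x).
Proof.
move=> [C C0 fC] [D D0 gD]; exists (n%:R * (C * D) *+ 2).
  by rewrite mulrn_wge0 // !mulr_ge0.
move=> r x y r1 xr yr; have r0 : 0 <= r by apply: le_trans xr.
have [f1 f2] := fC _ _ _ r1 xr yr; have [g1 g2] := gD _ _ _ r1 xr yr.
have [f1' _] := fC _ _ _ r1 yr yr; split.
  apply: le_trans (ler_norm_mulmx _ _) _.
  rewrite mulr2n mulrDl -[leLHS]addr0 lerD //; last first.
    by apply: mulr_ge0; rewrite ?exprn_ge0 // !mulr_ge0.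
  rewrite -mulrA ler_wpM2l // (le_trans (ler_pM _ _ f1 g1)) //.
  by rewrite -addnS -addSn exprD le_eqVlt; apply/orP; left; apply/eqP; ring.
have -> : f x *m g x - f y *m g y = (f x - f y) *m g x + f y *m (g x - g y).
  by rewrite mulmxBl mulmxBr addrA subrK.
rewrite mulr2n !mulrDl (le_trans (ler_normD _ _)) // lerD //.
  rewrite (le_trans (ler_norm_mulmx _ _)) // -!mulrA ler_wpM2l //.
  rewrite (le_trans (ler_pM _ _ f2 g1)) // -addnS exprD le_eqVlt.
  by apply/orP; left; apply/eqP; ring.
rewrite (le_trans (ler_norm_mulmx _ _)) // -!mulrA ler_wpM2l //.
rewrite (le_trans (ler_pM _ _ f1' g2)) // -addSn exprD le_eqVlt.
by apply/orP; left; apply/eqP; ring.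
Qed.

(** An implicit function theorem along the line spanned by [v]: for small [t]
    the map [w |-> f (t v + S w)] contracts the ball of radius [M t^2], on which
    its argument has norm at most [t (|v| + 1)].  That [w] is [O(t^2)] is what
    makes [t v] the leading term. *)
Lemma vanishing_fixpoint (V : normedModType R) (W : completeNormedModType R)
    (S : W -> V) s (f : V -> W) v :
  S 0 = 0 -> (forall x y, `|S x - S y| <= s * `|x - y|) -> vanishing 1 f ->
  exists M d, [/\ 0 <= M, 0 < d & forall t, 0 < t -> t <= d ->
    exists2 w, `|w| <= M * t ^+ 2 & w = f (t *: v + S w)].
Proof.
move=> S0 Sl [C C0 fC]; pose c := `|v| + 1.
have c1 : 1 <= c by rewrite lerDr.
have [s' s0 {}Sl] : exists2 s', 0 <= s' &
    forall x y, `|S x - S y| <= s' * `|x - y|.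
  exists `|s| => // x y.
  by rewrite (le_trans (Sl x y)) // ler_wpM2r // ler_norm.
have Ss w : `|S w| <= s' * `|w| by have := Sl w 0; rewrite S0 !subr0.
pose M := C * c ^+ 2; have M0 : 0 <= M by rewrite mulr_ge0 // sqr_ge0.
(* The bound [t q <= 1] collects all the smallness conditions on [t]. *)
pose q := c + s' * M + 2 * (C * c * s').
have qc : c <= q.
  by rewrite /q -addrA lerDl addr_ge0 ?mulr_ge0 // (le_trans _ c1).
have qM : s' * M <= q.
  by rewrite /q addrAC lerDr addr_ge0 ?mulr_ge0 // (le_trans _ c1).
have qC : 2 * (C * c * s') <= q.
  by rewrite /q lerDr addr_ge0 ?mulr_ge0 // (le_trans _ c1).
have q1 : 1 <= q by apply: le_trans qc.
exists M, q^-1; split=> // [|t t0 tq]; first by rewrite invr_gt0; lra.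
have {}tq : t * q <= 1 by rewrite -ler_pdivlMr ?div1r //; lra.
pose r := t * c.
have r1 : r <= 1 by rewrite (le_trans _ tq) // ler_pM2l.
have sM : s' * (M * t ^+ 2) <= t.
  rewrite mulrA expr2 mulrA ler_piMl ?(ltW t0) // (le_trans _ tq) //.
  by rewrite mulrC ler_pM2l.
have Cs : C * r * s' <= 2^-1.
  have : t * (2 * (C * c * s')) <= 1 by rewrite (le_trans _ tq) // ler_pM2l.
  by rewrite /r; lra.
pose U := [set w : W | `|w| <= M * t ^+ 2]%classic.
pose g w := f (t *: v + S w).
have bnd w : U w -> `|t *: v + S w| <= r.
  move=> Uw; rewrite /r /c mulrDr mulr1 (le_trans (ler_normD _ _)) // normrZ.
  rewrite gtr0_norm // lerD // (le_trans (Ss w)) // (le_trans _ sM) //.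
  exact: ler_wpM2l.
have gU : set_fun U U g.
  move=> w Uw; have [+ _] := fC _ _ _ r1 (bnd w Uw) (bnd w Uw).
  by rewrite /U /= /M /r exprMn mulrA mulrAC mulrA.
pose gF : {fun U >-> U} := mkfun gU.
have [|//||w Uw wE] := @banach_fixed_point R W U gF.
- exists (2^-1)%:nng; split=> /= [|[x y] [Ux Uy]] /=; first by lra.
  have [_ +] := fC _ _ _ r1 (bnd x Ux) (bnd y Uy).
  rewrite expr1 opprD addrACA subrr add0r => /le_trans; apply.
  rewrite -mulrA; apply: le_trans (_ : C * r * (s' * `|x - y|) <= _).
    by rewrite mulrA ler_wpM2l // mulr_ge0 // /r; nra.
  by rewrite mulrA ler_wpM2r.
- suff -> : U = closed_ball_ Num.Def.normr (0 : W) (M * t ^+ 2).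
    exact: closed_closed_ball_.
  by apply/seteqP; split=> w; rewrite /U /closed_ball_ /= sub0r normrN.
- by exists 0; rewrite /U /= normr0 mulr_ge0 // sqr_ge0.
- by exists w.
Qed.

End Vanishing.

(** * Perturbing along a liberation set *)

Section Perturbation.
Variables (R : realType) (n : nat).
Implicit Types (G : sgraph 'I_n) (A B E Z W : 'M[R]_n).
(* [T A] plays the role of the derivative at the identity of a group action on
   the symmetric matrices, and [r A] that of its terms of higher order. *)
Variables (T : 'M[R]_n -> {linear 'M[R]_n -> 'M[R]_n}) (c : R).
Variable r : 'M[R]_n -> 'M[R]_n * 'M[R]_n -> 'M[R]_n.
Hypothesis Tsym : forall A Z, A^T = A -> (T A Z)^T = T A Z.
Hypothesis Tlip :
  forall A B Z, `|T B Z - T A Z| <= c * (`|B - A| * `|Z|).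
Hypothesis rsym :
  forall A Z E, A^T = A -> E^T = E -> (r A (Z, E))^T = r A (Z, E).
Hypothesis rvan : forall A, vanishing 1 (r A).

(** With [z0] a generic direction and [e0 := T A z0], the unknowns are sought as
    [Z = t z0 - S1 W] and [E = t e0 + S2 W], where [S1] and [S2] solve
    [W = T A (S1 W) + S2 W].  Then [E - T A Z = W], so the equation becomes the
    fixed-point problem [W = r A (Z, E)], and [E] is supported on [G + b]
    automatically. *)
Lemma liberation_perturbation G A (b : {set {set 'I_n}}) eps :
  in_S G A -> b != finset.set0 -> b \subset edges (compl G) ->
  (forall f, f \in b -> transverse (T A) (add_edges G (b :\ f))) -> 0 < eps ->
  exists Z E, [/\ `|Z| <= eps, E = T A Z + r A (Z, E),
    in_S (add_edges G b) (A + E) & transverse (T (A + E)) (add_edges G b)].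
Proof.
move=> [As Anz] bn0 /fintype.subsetP bG trb eps0; set H := add_edges G b.
have TAs Z : (T A Z)^T = T A Z by exact: Tsym.
have trH : transverse (T A) H.
  have /set0Pn[f fb] := bn0; apply: transverse_sub (trb f fb) => i j.
  by move=> /andP[ij /orP[Gij|]]; rewrite /= /add_rel ij ?Gij // !inE
    => /andP[_ ->]; rewrite orbT.
have [S1 [S2 [solve S2H]]] := transverse_solve TAs trH.
have [z0 [e0H e0nz]] := generic_direction TAs bG trb.
have [e e_gt0 open] := transverse_open TAs (Tlip A) trH.
set e0 := T A z0 in e0H e0nz.
have [s1 s1_ge0 S1s] := linear_mx_bounded S1.
have [s2 s2_ge0 S2s] := linear_mx_bounded S2.
pose S (W : 'M[R]_n) : 'M[R]_n * 'M[R]_n := (- S1 W, S2 W); pose s := s1 + s2.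
have S_0 : S 0 = 0 by rewrite /S !linear0.
have S_lip W W' : `|S W - S W'| <= s * `|W - W'|.
  have -> : S W - S W' = (- S1 (W - W'), S2 (W - W')).
    by rewrite (linearB S1) (linearB S2) (opprD (S1 W)).
  rewrite prod_normE ge_max /= normrN; apply/andP.
  by split; apply: le_trans (_ : _ <= _) _; [exact: S1s | | exact: S2s |];
    rewrite ler_wpM2r // ?lerDl ?lerDr.
have [M [d [M0 d0 fix_t]]] :=
  @vanishing_fixpoint R ('M[R]_n * 'M[R]_n)%type 'M[R]_n S s (r A) (z0, e0)
    S_0 S_lip (rvan A).
have [mA mA0 leA] := nonzero_entries_bound A.
have [me me0 lee] := nonzero_entries_bound e0.
pose K := `|z0| + `|e0| + s * M + 1.
have sM0 : 0 <= s * M by rewrite mulr_ge0 // addr_ge0.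
have K1 : 1 <= K by rewrite lerDr !addr_ge0.
(* [t K] bounds [Z] and [E] in norm, and also [S2 W] relative to [t]. *)
pose dl := Num.min 1 (Num.min eps (Num.min e (Num.min mA me))).
have dl0 : 0 < dl by rewrite !lt_min ltr01 eps0 e_gt0 mA0 me0.
have K0 : 0 < K by apply: lt_le_trans K1.
pose t := Num.min d (dl / (2 * K)).
have t0 : 0 < t by rewrite lt_min d0 divr_gt0 // mulr_gt0.
have td : t <= d by rewrite ge_min lexx.
have : t * K < dl.
  rewrite -ltr_pdivlMr // /t gt_min; apply/orP; right.
  by rewrite ltr_pM2l // invfM gtr_pMl ?invr_gt0 // invf_lt1 // ltr1n.
rewrite !lt_min => /and5P[tK1 tKeps tKe tKA tKm].
have t1 : t <= 1 by rewrite (le_trans _ (ltW tK1)) // ler_peMr // ltW.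
have [W WM WE] := fix_t t t0 td.
have {WE} : W = r A (t *: z0 - S1 W, t *: e0 + S2 W) by [].
set Z := _ - _; set E := _ + _ => WE.
have sMK : s * (M * t ^+ 2) <= t * (s * M).
  have -> : s * (M * t ^+ 2) = (s * M * t) * t by ring.
  by rewrite [leRHS]mulrC ler_pM2r // ler_piMr.
have S1W : `|S1 W| <= t * (s * M).
  apply: le_trans sMK; apply: le_trans (S1s W) _.
  by apply: ler_pM => //; rewrite lerDl.
have S2W : `|S2 W| <= s * (M * t ^+ 2).
  apply: le_trans (S2s W) _; apply: ler_pM => //; rewrite lerDr //.
have ZtK : `|Z| <= t * K.
  rewrite (le_trans (ler_normB _ _)) // normrZ gtr0_norm //.
  rewrite (le_trans (lerD (lexx _) S1W)) // -mulrDr ler_pM2l // /K.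
  by rewrite -!addrA lerD2l addrCA lerDl addr_ge0.
have EtK : `|E| <= t * K.
  rewrite (le_trans (ler_normD _ _)) // normrZ gtr0_norm //.
  rewrite (le_trans (lerD (lexx _) (le_trans S2W sMK))) // -mulrDr ler_pM2l //.
  by have := normr_ge0 z0; rewrite /K; lra.
have S2sym : (S2 W)^T = S2 W by case: (S2H W).
have Es : E^T = E by rewrite linearD linearZ /= S2sym TAs.
have Ws : W^T = W by rewrite WE rsym.
have EE : E = T A Z + r A (Z, E).
  by rewrite -WE {1}(solve W Ws) /E /Z linearB linearZ /= addrA subrK.
have E0 i j : i != j -> ~~ H i j -> E i j = 0.
  move=> ij nH; rewrite !mxE; case: e0H => _ ->//; case: (S2H W) => _ ->//.
  by rewrite mulr0 addr0.
exists Z, E; split=> //.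
- by rewrite (le_trans ZtK) // ltW.
- split=> [|i j ij]; first by rewrite linearD /= As Es.
  rewrite /= /add_rel ij /= -(Anz i j ij).
  rewrite [(A + E) i j]mxE; have [Aij0|Aij /=] := eqVneq (A i j) 0; last first.
    rewrite addr_eq0; apply: contraTneq (leA i j Aij) => ->.
    rewrite normrN -ltNge (le_lt_trans (ler_mx_norm _ _ _)) //.
    exact: le_lt_trans EtK _.
  rewrite Aij0 add0r; have [ijb|ijb] := boolP (_ \in b); last first.
    by rewrite E0 ?eqxx //= /add_rel ij -(Anz i j ij) Aij0 eqxx.
  (* On [b] the entry of [t e0] is of order [t] and that of [S2 W] of order
     [t^2], so they cannot cancel. *)
  rewrite mxE [X in X + _]mxE addr_eq0.
  apply: contraTneq (lee i j (e0nz i j ijb)) => te0; rewrite -ltNge.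
  rewrite -(ltr_pM2l t0) -{1}(gtr0_norm t0) -normrM te0 normrN.
  rewrite (le_lt_trans (ler_mx_norm _ _ _)) // (le_lt_trans S2W) //.
  rewrite (_ : s * (M * t ^+ 2) = t * (t * (s * M))); last by ring.
  rewrite ltr_pM2l // (le_lt_trans _ tKm) // ler_pM2l //.
  by rewrite /K addrAC lerDr addr_ge0.
- by apply: open; rewrite (addrC A) addrK (le_trans EtK) // ltW.
Qed.

End Perturbation.

(** * The two matrix manifolds *)

Section Tangents.
Variables (R : realType) (n : nat).
Implicit Types (H : sgraph 'I_n) (A B E X Z : 'M[R]_n).

(** Parametrizes the skew matrices by all matrices, so that both group actions
    have the same parameter space. *)
Definition skew Z : 'M[R]_n := Z - Z^T.

Lemma skew_is_linear : linear skew.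
Proof.
move=> a X Y; rewrite /skew linearD linearZ /= scalerBr.
by rewrite opprD addrACA.
Qed.
HB.instance Definition _ := GRing.isLinear.Build R 'M[R]_n 'M[R]_n _
  skew skew_is_linear.

Lemma trmx_skew Z : (skew Z)^T = - skew Z.
Proof. by rewrite /skew linearB /= trmxK opprB. Qed.

(** The linear part of [cayley_equation], for [K = skew Z]. *)
Definition similarity_tangent A Z : 'M[R]_n :=
  2 *: (A *m skew Z - skew Z *m A).

Lemma similarity_tangent_is_linear A : linear (similarity_tangent A).
Proof.
move=> a X Y; rewrite /similarity_tangent linearP /= mulmxDr mulmxDl.
rewrite -scalemxAr -scalemxAl opprD addrACA -scalerBr scalerDr.
by rewrite scalerA mulrC -scalerA.
Qed.
HB.instance Definition _ A := GRing.isLinear.Build R 'M[R]_n 'M[R]_n _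
  (similarity_tangent A) (similarity_tangent_is_linear A).

(** The part of order at least two of [cayley_equation]; [x] is the pair
    [(Z, E)] of unknowns. *)
Definition similarity_remainder A (x : 'M[R]_n * 'M[R]_n) : 'M[R]_n :=
  x.2 *m skew x.1 - skew x.1 *m x.2 + skew x.1 *m x.2 *m skew x.1.

(** The linear part in [Z] of [(1 + Z)^T A (1 + Z)]. *)
Definition congruence_tangent A Z : 'M[R]_n := Z^T *m A + A *m Z.

Lemma congruence_tangent_is_linear A : linear (congruence_tangent A).
Proof.
move=> a X Y; rewrite /congruence_tangent linearP /= mulmxDr mulmxDl.
by rewrite -scalemxAr -scalemxAl addrACA -scalerDr.
Qed.
HB.instance Definition _ A := GRing.isLinear.Build R 'M[R]_n 'M[R]_n _
  (congruence_tangent A) (congruence_tangent_is_linear A).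

(** The part of order two of [(1 + Z)^T A (1 + Z)], with the same pair [(Z, E)]
    of unknowns as [similarity_remainder]. *)
Definition congruence_remainder A (x : 'M[R]_n * 'M[R]_n) : 'M[R]_n :=
  x.1^T *m A *m x.1.

Lemma mxtrace_mul_eq0 X : (forall Z, \tr (X *m Z) = 0) -> X = 0.
Proof.
move=> X0; apply/matrixP => i j.
by rewrite -mxtrace_mul_delta X0 mxE.
Qed.

(** The commutator of two symmetric matrices is skew, so pairing it with [Z] and
    with [- Z^T] gives the same value; this doubles the factor [2] of the
    tangent map. *)
Lemma mxtrace_similarity_tangent A X Z : A^T = A -> X^T = X ->
  \tr (X *m similarity_tangent A Z) = 4 * \tr ((X *m A - A *m X) *m Z).
Proof.
move=> As Xs; rewrite /similarity_tangent -scalemxAr mxtraceZ.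
have swap (K : 'M[R]_n) : \tr (X *m (A *m K - K *m A)) =
    \tr ((X *m A - A *m X) *m K).
  rewrite mulmxBr mulmxBl !(raddfB (@mxtrace R n)) /= mulmxA; congr (_ - _).
  by rewrite mulmxA mxtrace_mulC mulmxA.
have anti : \tr ((X *m A - A *m X) *m Z^T) = - \tr ((X *m A - A *m X) *m Z).
  have Cs : (X *m A - A *m X)^T = - (X *m A - A *m X).
    by rewrite linearB /= !trmx_mul As Xs opprB.
  by rewrite -mxtrace_tr trmx_mul trmxK mxtrace_mulC Cs mulNmx raddfN.
rewrite swap /skew mulmxBr (raddfB (@mxtrace R n)) /= anti.
by ring.
Qed.

Lemma mxtrace_congruence_tangent A X Z : A^T = A -> X^T = X ->
  \tr (X *m congruence_tangent A Z) = 2 * \tr ((X *m A) *m Z).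
Proof.
move=> As Xs; rewrite /congruence_tangent mulmxDr linearD /= mulmxA.
have -> : \tr (X *m Z^T *m A) = \tr (X *m A *m Z).
  rewrite -mxtrace_tr !trmx_mul trmxK As Xs mxtrace_mulC.
  by rewrite -mulmxA mxtrace_mulC.
by rewrite mulmxA; ring.
Qed.

(** The trace pairing is nondegenerate, so orthogonality to all tangent vectors
    is the vanishing of the commutator. *)
Lemma has_SSP_transverse H A : A^T = A ->
  has_SSP_wrt H A <-> transverse (similarity_tangent A) H.
Proof.
move=> As; split=> hA X hX X0; apply: hA => //; have [Xs _ _] := hX.
  apply/eqP; rewrite -oppr_eq0 opprB; apply/eqP/mxtrace_mul_eq0 => Z.
  by have := X0 Z; rewrite /= mxtrace_similarity_tangent //; lra.
move=> Z; rewrite /= mxtrace_similarity_tangent //.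
by rewrite -[_ - _]opprB X0 oppr0 mul0mx mxtrace0 mulr0.
Qed.

Lemma has_SAP_transverse H A : A^T = A ->
  has_SAP_wrt H A <-> transverse (congruence_tangent A) H.
Proof.
move=> As; split=> hA X hX X0; apply: hA => //; have [Xs _ _] := hX.
  rewrite -[LHS]trmxK trmx_mul As Xs [X *m A]mxtrace_mul_eq0 ?trmx0 // => Z.
  by have := X0 Z; rewrite /= mxtrace_congruence_tangent //; lra.
move=> Z; rewrite /= mxtrace_congruence_tangent //.
by rewrite -[X *m A]trmxK trmx_mul As Xs X0 trmx0 mul0mx mxtrace0 mulr0.
Qed.

Lemma similarity_tangent_sym A Z : A^T = A ->
  (similarity_tangent A Z)^T = similarity_tangent A Z.
Proof.
move=> As; rewrite /similarity_tangent linearZ linearB /= !trmx_mul.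
rewrite trmx_skew As.
by rewrite mulNmx mulmxN opprK addrC.
Qed.

Lemma similarity_remainder_sym A Z E : E^T = E ->
  (similarity_remainder A (Z, E))^T = similarity_remainder A (Z, E).
Proof.
move=> Es; rewrite /similarity_remainder /= linearD linearB /= !trmx_mul.
by rewrite trmx_skew Es !mulmxA !mulNmx !mulmxN !opprK [- _ + _]addrC.
Qed.

Lemma congruence_tangent_sym A Z : A^T = A ->
  (congruence_tangent A Z)^T = congruence_tangent A Z.
Proof.
by move=> As; rewrite /congruence_tangent linearD /= !trmx_mul trmxK As addrC.
Qed.

Lemma congruence_remainder_sym A Z E : A^T = A ->
  (congruence_remainder A (Z, E))^T = congruence_remainder A (Z, E).
Proof.
by move=> As; rewrite /congruence_remainder !trmx_mul trmxK As mulmxA.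
Qed.

Lemma ler_norm_skew Z : `|skew Z| <= 2 * `|Z|.
Proof.
rewrite (le_trans (ler_normB _ _)) // mulr2n mulrDl mul1r.
by rewrite lerD2l ler_norm_trmx.
Qed.

Lemma similarity_tangent_lip A B Z :
  `|similarity_tangent B Z - similarity_tangent A Z| <=
    (8 * n%:R) * (`|B - A| * `|Z|).
Proof.
have -> : similarity_tangent B Z - similarity_tangent A Z =
    similarity_tangent (B - A) Z.
  rewrite /similarity_tangent; move: (skew Z) => K.
  rewrite -scalerBr mulmxBl mulmxBr.
  by rewrite !opprD !opprK addrACA.
have bnd (D : 'M[R]_n) : `|D *m skew Z| <= n%:R * (`|D| * (2 * `|Z|)).
  rewrite (le_trans (ler_norm_mulmx _ _)) // ler_wpM2l // ler_wpM2l //.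
  exact: ler_norm_skew.
have bnd' (D : 'M[R]_n) : `|skew Z *m D| <= n%:R * (`|D| * (2 * `|Z|)).
  rewrite (le_trans (ler_norm_mulmx _ _)) // ler_wpM2l // mulrC ler_wpM2l //.
  exact: ler_norm_skew.
rewrite normrZ normr_nat (le_trans (ler_wpM2l _ (ler_normB _ _))) //.
rewrite (le_trans (ler_wpM2l _ (lerD (bnd _) (bnd' _)))) //.
by rewrite le_eqVlt; apply/orP; left; apply/eqP; ring.
Qed.

Lemma congruence_tangent_lip A B Z :
  `|congruence_tangent B Z - congruence_tangent A Z| <=
    (2 * n%:R) * (`|B - A| * `|Z|).
Proof.
rewrite /congruence_tangent opprD addrACA -mulmxBr -mulmxBl.
rewrite (le_trans (ler_normD _ _)) // mulr2n mulrDl mul1r mulrDl.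
rewrite lerD // (le_trans (ler_norm_mulmx _ _)) // ler_wpM2l //.
by rewrite mulrC ler_wpM2l // ler_norm_trmx.
Qed.

Lemma vanishing_fst : vanishing 0 (fun x : 'M[R]_n * 'M[R]_n => x.1).
Proof.
apply: (@vanishing_linear R _ _ fst 1) => x.
by rewrite mul1r prod_normE le_max lexx.
Qed.

Lemma vanishing_snd : vanishing 0 (fun x : 'M[R]_n * 'M[R]_n => x.2).
Proof.
apply: (@vanishing_linear R _ _ snd 1) => x.
by rewrite mul1r prod_normE le_max lexx orbT.
Qed.

Lemma vanishing_skew_fst :
  vanishing 0 (fun x : 'M[R]_n * 'M[R]_n => skew x.1).
Proof.
apply: (@vanishing_linear R _ _ (skew \o fst) 2) => x.
by rewrite (le_trans (ler_norm_skew _)) // ler_wpM2l // prod_normE le_max lexx.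
Qed.

Lemma vanishing_similarity_remainder A : vanishing 1 (similarity_remainder A).
Proof.
have EK := vanishing_mulmx vanishing_snd vanishing_skew_fst.
have KE := vanishing_mulmx vanishing_skew_fst vanishing_snd.
have KEK := vanishing_weaken (vanishing_mulmx KE vanishing_skew_fst).
exact: vanishingD (vanishingD EK (vanishingN KE)) KEK.
Qed.

Lemma vanishing_congruence_remainder A : vanishing 1 (congruence_remainder A).
Proof.
suff trA : vanishing 0 (fun x : 'M[R]_n * 'M[R]_n => x.1^T *m A).
  exact: vanishing_mulmx trA vanishing_fst.
apply: (@vanishing_linear R _ _ (mulmxr A \o trmx \o fst) (n%:R * `|A|)) => x.
rewrite /= (le_trans (ler_norm_mulmx _ _)) // -mulrA ler_wpM2l //.
rewrite mulrC ler_wpM2l // (le_trans (ler_norm_trmx _)) //.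
by rewrite prod_normE le_max lexx.
Qed.

(** Clearing denominators in [B = Q^T A Q], where [Q = (1 + K) (1 - K)^-1] is
    orthogonal, gives the conclusion with [B = A + E]; in its expansion [A] and
    [K A K] cancel, which leaves the hypothesis. *)
Lemma cayley_equation A E (K : 'M[R]_n) :
  E = 2 *: (A *m K - K *m A) + (E *m K - K *m E + K *m E *m K) ->
  (1%:M + K) *m (A + E) *m (1%:M - K) = (1%:M - K) *m A *m (1%:M + K).
Proof.
rewrite !(mulmxDl, mulmxDr, mulmxBl, mulmxBr, mul1mx, mulmx1, mulmxN, mulNmx).
move: (A *m K) (K *m A) (E *m K) (K *m E) (K *m E *m K) (K *m A *m K).
move=> AK KA EK KE KEK KAK /matrixP EE; apply/matrixP => i j.
by have := EE i j; rewrite !mxE; lra.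
Qed.

Lemma congruence_equation A Z E :
  (1%:M + Z)^T *m A *m (1%:M + Z) =
    A + (congruence_tangent A Z + congruence_remainder A (Z, E)).
Proof.
rewrite /congruence_tangent /congruence_remainder /=.
rewrite [(1%:M + Z)^T]linearD /= tr_scalar_mx mulmxDl mul1mx mulmxDr mulmx1.
by rewrite mulmxDl !addrA.
Qed.

Lemma commute_1DB (K : 'M[R]_n) :
  (1%:M + K) *m (1%:M - K) = (1%:M - K) *m (1%:M + K).
Proof.
rewrite mulmxDl mulmxBl !mul1mx !mulmxDr !mulmx1 mulmxN opprD.
by rewrite addrA subrK addrA addrK.
Qed.

(** A row [v] with [v = - v Z] satisfies [|v| <= n |Z| |v|]. *)
Lemma small_unit Z : `|Z| <= (n%:R + 1)^-1 -> 1%:M + Z \in unitmx.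
Proof.
move=> Zs; rewrite -row_free_unit -kermx_eq0; apply/eqP/row_matrixP => i.
rewrite row0; set v := row i _.
have vZ : v = - (v *m Z).
  have /eqP : v *m (1%:M + Z) = 0 by rewrite -row_mul mulmx_ker row0.
  by rewrite mulmxDr mulmx1 addr_eq0 => /eqP.
apply/eqP; rewrite -normr_eq0; apply/eqP.
have : `|v| <= n%:R * (n%:R + 1)^-1 * `|v|.
  rewrite {1}vZ normrN (le_trans (ler_norm_mulmx _ _)) // -mulrA ler_wpM2l //.
  by rewrite mulrC ler_wpM2r.
have n1 : n%:R * (n%:R + 1)^-1 < 1 :> R.
  by rewrite ltr_pdivrMr ?ltr_wpDl // mul1r ltrDl.
by have := normr_ge0 v; nra.
Qed.

End Tangents.

(** * Liberation sets *)

Theorem lemma2p2 (R : realType) (n : nat) (G : sgraph 'I_n) (A : 'M[R]_n)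
    (b : {set {set 'I_n}}) (hA : in_S G A)
    (hb : b \subset edges (compl G)) :
  (SSP_liberation_set G A b ->
     exists A' : 'M[R]_n,
       [/\ in_S (add_edges G b) A', has_SSP_wrt (add_edges G b) A'
         & spec A = spec A']) /\
  (SAP_liberation_set G A b ->
     exists A' : 'M[R]_n,
       [/\ in_S (add_edges G b) A', has_SAP_wrt (add_edges G b) A'
         & \rank A = \rank A']).
Proof.
have As : A^T = A by case: hA.
split=> -[bn0 _ lib].
- have trb f : f \in b ->
      transverse (similarity_tangent A) (add_edges G (b :\ f)).
    move=> fb; apply/has_SSP_transverse => //; apply: lib.
      exact: finset.subD1set.
    by rewrite (cardsD1 f b) fb.
  have [Z [E [_ EE BG Btr]]] := @liberation_perturbation R n
    (fun A => similarity_tangent A) _ (similarity_remainder (n:=n))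
    (fun B Z => @similarity_tangent_sym R n B Z) (@similarity_tangent_lip R n)
    (fun B Z E _ => @similarity_remainder_sym R n B Z E)
    (@vanishing_similarity_remainder R n) G A b 1 hA bn0 hb trb ltr01.
  have Bs : (A + E)^T = A + E by case: BG.
  exists (A + E); split=> //; first exact/has_SSP_transverse.
  rewrite /spec; suff -> : char_poly A = char_poly (A + E) by [].
  have KT := trmx_skew Z.
  have KT' : (- skew Z)^T = - - skew Z by rewrite linearN /= KT.
  apply: (char_poly_equiv (skew_unit KT') (skew_unit KT)).
    by rewrite opprK commute_1DB.
  by rewrite opprK; apply: cayley_equation.
- have trb f : f \in b ->
      transverse (congruence_tangent A) (add_edges G (b :\ f)).
    move=> fb; apply/has_SAP_transverse => //; apply: lib.
      exact: finset.subD1set.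
    by rewrite (cardsD1 f b) fb.
  have n1 : 0 < (n%:R + 1)^-1 :> R by rewrite invr_gt0 ltr_wpDl.
  have [Z [E [Zs EE BG Btr]]] := @liberation_perturbation R n
    (fun A => congruence_tangent A) _ (congruence_remainder (n:=n))
    (fun B Z => @congruence_tangent_sym R n B Z) (@congruence_tangent_lip R n)
    (fun B Z E Bs _ => @congruence_remainder_sym R n B Z E Bs)
    (@vanishing_congruence_remainder R n) G A b _ hA bn0 hb trb n1.
  have Bs : (A + E)^T = A + E by case: BG.
  exists (A + E); split=> //; first exact/has_SAP_transverse.
  have U := small_unit Zs.
  have -> : A + E = (1%:M + Z)^T *m A *m (1%:M + Z).
    by rewrite (congruence_equation A Z E) -EE.
  rewrite mxrankMfree ?row_free_unit //.
  by rewrite (eqmxMfull A) // row_full_unit unitmx_tr.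
Qed.
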